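(* Let $0< v_i^l\le v_i^u$, $0< v_j^l\le v_j^u$ and $-\pi/2<\theta_{ij}^l<\theta_{ij}^u<\pi/2$ be real constants, and put $$\phi_{ij}=\tfrac{\theta_{ij}^u+\theta_{ij}^l}{2},\quad \delta_{ij}=\tfrac{\theta_{ij}^u-\theta_{ij}^l}{2},\quad v_i^\sigma=v_i^l+v_i^u,\quad v_j^\sigma=v_j^l+v_j^u,$$ $$c_{21}=v_i^\sigma v_j^\sigma\cos\phi_{ij},\quad c_{22}=v_i^\sigma v_j^\sigma\sin\phi_{ij},\quad c_{23}=-v_j^l\cos(\delta_{ij})v_j^\sigma,\quad c_{24}=-v_i^l\cos(\delta_{ij})v_i^\sigma,$$ $$c_{25}=v_i^lv_j^l\cos(\delta_{ij})\,(v_i^lv_j^l-v_i^uv_j^u).$$ Then every $(w^R_{ij},w^I_{ij},w_i)\in\mathcal S_p$ (with $\mathcal S_p\subset\mathbb{R}^3$ defined in the context) satisfies $$c_{21}w^R_{ij}+c_{22}w^I_{ij}+c_{23}w_i+c_{24}\frac{(w^R_{ij})^2+(w^I_{ij})^2}{w_i}+c_{25}\ge 0 .$$ That is, this nonlinear cut is redundant with respect to $\mathcal S_p$.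
   Context: $\mathcal S_p$ is the set of all $(w^R_{ij},w^I_{ij},w_i)\in\mathbb{R}^3$ such that (1) $(v_i^l)^2\le w_i\le (v_i^u)^2$; (2) $w^{Rl}_{ij}\le w^R_{ij}\le w^{Ru}_{ij}$; (3) $w^{Il}_{ij}\le w^I_{ij}\le w^{Iu}_{ij}$; (4) $\tan(\theta^l_{ij})w^R_{ij}\le w^I_{ij}\le\tan(\theta^u_{ij})w^R_{ij}$; (5) $w_i(v_j^l)^2\le (w^R_{ij})^2+(w^I_{ij})^2\le w_i(v_j^u)^2$. The bounds in (2),(3) are the following constants. If $\theta^l_{ij},\theta^u_{ij}\le 0$: $w^{Rl}_{ij}=v^l_iv^l_j\cos\theta^l_{ij}$, $w^{Ru}_{ij}=v^u_iv^u_j\cos\theta^u_{ij}$, $w^{Il}_{ij}=v^u_iv^u_j\sin\theta^l_{ij}$, $w^{Iu}_{ij}=v^l_iv^l_j\sin\theta^u_{ij}$. If $\theta^l_{ij},\theta^u_{ij}\ge 0$: $w^{Rl}_{ij}=v^l_iv^l_j\cos\theta^u_{ij}$, $w^{Ru}_{ij}=v^u_iv^u_j\cos\theta^l_{ij}$, $w^{Il}_{ij}=v^l_iv^l_j\sin\theta^l_{ij}$, $w^{Iu}_{ij}=v^u_iv^u_j\sin\theta^u_{ij}$. If $\theta^l_{ij}<0<\theta^u_{ij}$: $w^{Rl}_{ij}=v^l_iv^l_j\min(\cos\theta^l_{ij},\cos\theta^u_{ij})$, $w^{Ru}_{ij}=v^u_iv^u_j$, $w^{Il}_{ij}=v^u_iv^u_j\sin\theta^l_{ij}$,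 $w^{Iu}_{ij}=v^u_iv^u_j\sin\theta^u_{ij}$. A constraint is redundant with respect to a set if every point of the set satisfies it. *)

(* Defs.v *)
From Stdlib Require Import Reals.
Open Scope R_scope.

(** Bounds on [wR = v_i v_j cos th] and [wI = v_i v_j sin th] implied by
    [vil <= v_i <= viu], [vjl <= v_j <= vju], [thl <= th <= thu].  For
    [thl < thu] exactly one of the three [bound_case] conditions holds. *)

Definition bound_case (thl thu : R) (nonpos nonneg mixed : R) : R :=
  if Rle_dec thl 0 then
    if Rle_dec thu 0 then nonpos        (* thl, thu <= 0 *)
    else if Rle_dec 0 thl then nonneg   (* thl = 0 < thu *)
    else mixed                          (* thl < 0 < thu *)
  else nonneg.                          (* 0 < thl (< thu) *)

Definition wR_lower (vil viu vjl vju thl thu : R) : R :=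
  bound_case thl thu
    (vil * vjl * cos thl)
    (vil * vjl * cos thu)
    (vil * vjl * Rmin (cos thl) (cos thu)).

Definition wR_upper (vil viu vjl vju thl thu : R) : R :=
  bound_case thl thu
    (viu * vju * cos thu)
    (viu * vju * cos thl)
    (viu * vju).

Definition wI_lower (vil viu vjl vju thl thu : R) : R :=
  bound_case thl thu
    (viu * vju * sin thl)
    (vil * vjl * sin thl)
    (viu * vju * sin thl).

Definition wI_upper (vil viu vjl vju thl thu : R) : R :=
  bound_case thl thu
    (vil * vjl * sin thu)
    (viu * vju * sin thu)
    (viu * vju * sin thu).

Definition S_p (vil viu vjl vju thl thu : R) (w : R * R * R) : Prop :=
  let '(wR, wI, wi) := w in
  vil ^ 2 <= wi <= viu ^ 2 /\
  wR_lower vil viu vjl vju thl thu <= wR <= wR_upper vil viu vjl vju thl thu /\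
  wI_lower vil viu vjl vju thl thu <= wI <= wI_upper vil viu vjl vju thl thu /\
  tan thl * wR <= wI <= tan thu * wR /\
  wi * vjl ^ 2 <= wR ^ 2 + wI ^ 2 <= wi * vju ^ 2.

Definition redundant {T : Type} (C S : T -> Prop) : Prop :=
  forall x : T, S x -> C x.

(* Main.v *)
(** Polar coordinates: put [wi = x^2], [wR^2 + wI^2 = (x y)^2] with
    [vil <= x <= viu] and [vjl <= y <= vju].  The angle constraint gives
    [wR cos phi + wI sin phi >= x y cos delta], so after division by
    [cos delta > 0] the cut reduces to the polynomial inequality
    [box_quadratic_nonneg] on the box. *)

Require Import Defs.
From Stdlib Require Import Reals Psatz.
Open Scope R_scope.

(* The quadratic is concave in each variable; it vanishes at three corners
   of the box, which yields the decomposition below. *)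
Lemma box_quadratic_nonneg (a A b B x y : R) :
  0 < a -> 0 < b -> a <= x <= A -> b <= y <= B ->
  0 <= (a + A) * (b + B) * (x * y) - b * (b + B) * x ^ 2
         - a * (a + A) * y ^ 2 + a * b * (a * b - A * B).
Proof.
intros ha hb hx hy.
replace (_ + _) with
  (a * (a + A) * ((y - b) * (B - y)) + b * (b + B) * ((x - a) * (A - x))
   + (a + A) * (b + B) * ((x - a) * (y - b))) by ring.
repeat apply Rplus_le_le_0_compat; repeat apply Rmult_le_pos; lra.
Qed.

Lemma pow2_le_reg (x y : R) : 0 <= y -> x ^ 2 <= y ^ 2 -> x <= y.
Proof.
intros hy h; apply Rsqr_incr_0_var; [| exact hy].
now rewrite !Rsqr_pow2.
Qed.

Lemma tan_mul_le (t x y : R) :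
  0 < cos t -> tan t * x <= y -> x * sin t <= y * cos t.
Proof.
intros hc h.
replace (x * sin t) with (tan t * x * cos t) by (unfold tan; field; lra).
now apply Rmult_le_compat_r; [lra |].
Qed.

Lemma le_tan_mul (t x y : R) :
  0 < cos t -> y <= tan t * x -> y * cos t <= x * sin t.
Proof.
intros hc h.
replace (x * sin t) with (tan t * x * cos t) by (unfold tan; field; lra).
now apply Rmult_le_compat_r; [lra |].
Qed.

(** The point [(x, y)] lies in the sector of half-angle [delta] around the direction [phi], so its
    component along that axis is at least its length times [cos delta]. *)
Lemma sector_projection (phi delta x y r : R) :
  0 < cos (phi - delta) -> 0 < cos (phi + delta) -> 0 <= cos delta ->
  0 <= x -> r ^ 2 = x ^ 2 + y ^ 2 ->
  tan (phi - delta) * x <= y <= tan (phi + delta) * x ->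
  r * cos delta <= cos phi * x + sin phi * y.
Proof.
intros hl hu hd hx hr [h1 h2].
apply tan_mul_le in h1; [| exact hl].
apply le_tan_mul in h2; [| exact hu].
assert (Ephi := sin2_cos2 phi); assert (Edelta := sin2_cos2 delta).
unfold Rsqr in Ephi, Edelta.
(* Nonnegativity allows comparing squares below. The sign of [sin phi] decides which edge bounds
   [sin phi * y] from below; the cosine of a difference then leaves [x * cos delta]. *)
assert (P0 : 0 <= cos phi * x + sin phi * y).
{ destruct (Rle_lt_dec 0 (sin phi)) as [s | s].
  - apply Rmult_le_reg_l with (cos (phi - delta)); [exact hl |].
    apply Rle_trans with
      (x * (cos phi * cos (phi - delta) + sin phi * sin (phi - delta))).
    + rewrite <- cos_minus.
      replace (phi - (phi - delta)) with delta by ring.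
      rewrite Rmult_0_r; now apply Rmult_le_pos.
    + nra.
  - apply Rmult_le_reg_l with (cos (phi + delta)); [exact hu |].
    apply Rle_trans with
      (x * (cos (phi + delta) * cos phi + sin (phi + delta) * sin phi)).
    + rewrite <- cos_minus.
      replace (phi + delta - phi) with delta by ring.
      rewrite Rmult_0_r; now apply Rmult_le_pos.
    + nra. }
apply Rsqr_incr_0_var; [| exact P0].
(* [p^2 - r^2 (cos delta)^2 = p^2 (sin delta)^2 - q^2 (cos delta)^2] with
   [r^2 = p^2 + q^2], and the right side is the product of the two slacks
   [p sin delta + q cos delta] and [p sin delta - q cos delta]. *)
set (p := cos phi * x + sin phi * y) in *.
(* [(p, q)] is [(x, y)] rotated by [- phi], hence of the same norm. *)
set (q := cos phi * y - sin phi * x).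
assert (Er : r ^ 2 = p ^ 2 + q ^ 2).
{ rewrite hr; transitivity ((sin phi * sin phi + cos phi * cos phi)
                            * (x ^ 2 + y ^ 2)); [rewrite Ephi |];
  unfold p, q; ring. }
assert (H : 0 <= (p * sin delta + q * cos delta)
                 * (p * sin delta - q * cos delta)).
{ apply Rmult_le_pos; unfold p, q.
  (* By the addition formulas, the slacks of [h1] and [h2] are exactly the two factors. *)
  - rewrite sin_minus, cos_minus in h1; lra.
  - rewrite sin_plus, cos_plus in h2; lra. }
unfold Rsqr.
replace (r * cos delta * (r * cos delta))
  with ((p ^ 2 + q ^ 2) * (cos delta * cos delta)) by (rewrite <- Er; ring).
replace (p * p)
  with (p ^ 2 * (sin delta * sin delta + cos delta * cos delta))
  by (rewrite Edelta; ring).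
lra.
Qed.

(** Gives [wR > 0] on [S_p], as [sector_projection] requires a nonnegative abscissa. *)
Lemma wR_lower_pos (vil viu vjl vju thl thu : R) :
  0 < vil -> 0 < vjl -> 0 < cos thl -> 0 < cos thu ->
  0 < wR_lower vil viu vjl vju thl thu.
Proof.
intros hi hj hl hu.
assert (hm := Rmin_glb_lt _ _ _ hl hu).
unfold wR_lower, bound_case.
destruct (Rle_dec thl 0), (Rle_dec thu 0), (Rle_dec 0 thl);
  repeat apply Rmult_lt_0_compat; assumption.
Qed.

Theorem theorem4p4 (vil viu vjl vju thl thu : R)
  (hi0 : 0 < vil) (hi : vil <= viu)
  (hj0 : 0 < vjl) (hj : vjl <= vju)
  (hthl : - PI / 2 < thl) (hth : thl < thu) (hthu : thu < PI / 2) :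
  let phi := (thu + thl) / 2 in
  let delta := (thu - thl) / 2 in
  let vis := vil + viu in
  let vjs := vjl + vju in
  let c21 := vis * vjs * cos phi in
  let c22 := vis * vjs * sin phi in
  let c23 := - vjl * cos delta * vjs in
  let c24 := - vil * cos delta * vis in
  let c25 := vil * vjl * cos delta * (vil * vjl - viu * vju) in
  redundant
    (fun '(wR, wI, wi) =>
       c21 * wR + c22 * wI + c23 * wi
         + c24 * ((wR ^ 2 + wI ^ 2) / wi) + c25 >= 0)
    (S_p vil viu vjl vju thl thu).
Proof.
intros phi delta vis vjs c21 c22 c23 c24 c25 [[wR wI] wi]
  [[hwl hwu] [[hRl _] [_ [hang [hrl hru]]]]].
assert (cl : 0 < cos thl) by (apply cos_gt_0; lra).
assert (cu : 0 < cos thu) by (apply cos_gt_0; lra).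
assert (cd : 0 < cos delta) by (apply cos_gt_0; unfold delta; lra).
assert (hR := wR_lower_pos vil viu vjl vju thl thu hi0 hj0 cl cu).
replace thl with (phi - delta) in hang, cl by (unfold phi, delta; field).
replace thu with (phi + delta) in hang, cu by (unfold phi, delta; field).
assert (hw : 0 < wi) by nra.
set (x := sqrt wi).
assert (hx : 0 < x) by (apply sqrt_lt_R0; exact hw).
assert (Ex : x ^ 2 = wi) by (apply pow2_sqrt; lra).
set (y := sqrt ((wR ^ 2 + wI ^ 2) / wi)).
assert (Eq : wR ^ 2 + wI ^ 2 = (wR ^ 2 + wI ^ 2) / wi * wi) by (field; lra).
assert (hq : 0 <= (wR ^ 2 + wI ^ 2) / wi)
  by (apply Rle_mult_inv_pos; [nra | exact hw]).
assert (hy : 0 <= y) by apply sqrt_pos.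
assert (Ey : y ^ 2 = (wR ^ 2 + wI ^ 2) / wi) by (now apply pow2_sqrt).
rewrite <- Ey in *.
rewrite <- Ex in *.
assert (hxa : vil <= x <= viu) by (split; apply pow2_le_reg; lra).
assert (hyb : vjl <= y <= vju).
(* With [wR ^ 2 + wI ^ 2] written as [y ^ 2 * x ^ 2], the positive factor [x ^ 2] cancels. *)
{ rewrite Eq in hrl, hru.
  rewrite (Rmult_comm (x ^ 2)) in hrl, hru.
  apply Rmult_le_reg_r in hrl; [| exact hw].
  apply Rmult_le_reg_r in hru; [| exact hw].
  split; apply pow2_le_reg; lra. }
assert (K := box_quadratic_nonneg vil viu vjl vju x y hi0 hj0 hxa hyb).
assert (L : x * y * cos delta <= cos phi * wR + sin phi * wI).
{ apply sector_projection; try assumption; lra. }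
(* The cut is the sum of [L] scaled by [vis * vjs] and [K] scaled by [cos delta]: the [x * y] terms
   cancel. *)
apply (Rmult_le_compat_l (vis * vjs)) in L;
  [| apply Rmult_le_pos; unfold vis, vjs; lra].
apply (Rmult_le_pos (cos delta)) in K; [| lra].
unfold c21, c22, c23, c24, c25, vis, vjs in *; lra.
Qed.
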